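(* There are absolute constants $K>0$ and $c>0$ such that for every set $\Omega$, every nonempty class $F$ of real-valued functions on $\Omega$ bounded by $1$ in absolute value, and every $\varepsilon>0$, $$\mathrm{vc}(\mathrm{conv}(F),\varepsilon)\le (K/\varepsilon)^2\cdot\mathrm{vc}(F,c\varepsilon).$$
   Context: A subset $\sigma\subset\Omega$ is $t$-shattered by a class $F$ of real-valued functions on $\Omega$ if there is a function $h:\sigma\to\mathbb{R}$ such that for every $\sigma'\subset\sigma$ there is $f\in F$ with $f(x)\le h(x)-t$ for $x\in\sigma'$ and $f(x)\ge h(x)+t$ for $x\in\sigma\setminus\sigma'$. The shattering dimension $\mathrm{vc}(F,t)$ is the maximal cardinality of a subset of $\Omega$ that is $t$-shattered by $F$ (possibly $\infty$; $0$ if no nonempty set is shattered). $\mathrm{conv}(F)$ is the convex hull of $F$. *)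

(* Defs.v *)
From mathcomp Require Import all_boot all_order all_algebra.
From mathcomp Require Import all_classical all_reals all_analysis.

Set Implicit Arguments.
Unset Strict Implicit.
Unset Printing Implicit Defensive.

Import Order.TTheory GRing.Theory Num.Theory.

Local Open Scope classical_set_scope.
Local Open Scope ring_scope.

Definition shattered (R : realType) (Omega : Type) (t : R)
    (F : set (Omega -> R)) (s : set Omega) : Prop :=
  exists h : Omega -> R, (* only the values of h on s matter *)
    forall s' : set Omega, s' `<=` s ->
      exists2 f : Omega -> R, F f &
        (forall x, s' x -> f x <= h x - t) /\
        (forall x, (s `\` s') x -> h x + t <= f x).

(* The set of cardinalities contains 0 whatever F is, so that the supremum is 0
   when no nonempty set is shattered, even for empty F.  [counting] needs a
   choiceType, hence the alias [{classic Omega}]. *)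
Definition vc (R : realType) (Omega : Type) (F : set (Omega -> R)) (t : R)
    : \bar R :=
  ereal_sup [set @counting {classic Omega} R s
            | s in [set s : set Omega | s = set0 \/ shattered t F s]].

Definition conv_hull (R : realType) (Omega : Type) (F : set (Omega -> R))
    : set (Omega -> R) :=
  [set g | exists (n : nat) (w : 'I_n -> R) (f : 'I_n -> Omega -> R),
     [/\ forall i, 0 <= w i, \sum_(i < n) w i = 1, forall i, F (f i)
       & forall x, g x = \sum_(i < n) w i * f i x]].

(* Main.v *)
Require Import Defs.
From mathcomp Require Import all_boot all_order all_algebra.
From mathcomp Require Import all_classical all_reals all_analysis.
From mathcomp Require Import finmap.
From mathcomp Require Import zify ring lra.

(** Let [conv_hull F] shatter [n] points [x i] at scale [eps].  Every choice of
    signs [b] is then met by some [g] in the hull with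
    [sum_i b_i g(x_i) >= sum_i b_i h(x_i) + n eps], and, a linear functional
    being at most its largest value at the extreme points, also by some [f] in
    [F].  Averaging over [b] kills the level [h]: the Rademacher average of [F]
    on the [n] points is at least [n eps].

    Conversely the Rademacher average is bounded by chaining over nets of [F] at
    the scales [2 / 2^k], which needs the Mendelson-Vershynin entropy bound: if
    [F] shatters no more than [d] points at scale comparable with [2 / 2^k],
    then a family that is [2 / 2^k]-separated in mean square on the points has
    at most [exp (44 d (k + 1))] members, however many points there are
    ([l2_separated_entropy]).  As [sum_k (k + 1) / 2^k] converges, chaining
    gives [n eps <= C d / a + C' a n + n eps / 2] for every [a > 0]
    ([signed_sum_chaining]); taking [a] a small multiple of [eps] yields
    [n <= K^2 d / eps^2].

    The entropy bound has three ingredients.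
    - A random sample of about [log N / delta^2] of the points keeps a
      [delta]-separated family of [N] functions separated
      ([sample_separated]).  This makes the bound independent of [n].
    - After rounding to integers, a separated family always has a coordinate
      and a threshold which split it into two parts, neither too small, whose
      values lie above and below the threshold ([separated_splits]).  Iterating
      gives a binary tree with at least [sqrt N] leaves, and the leaves are
      dominated by the number of pairs (subset, level) that are shattered
      ([card_le_shattered_maps]).
    - There are few such pairs when the shattered subsets have at most [d]
      elements ([card_shattered_maps]). *)

Set Implicit Arguments.
Unset Strict Implicit.
Unset Printing Implicit Defensive.

Import Order.TTheory GRing.Theory Num.Theory.

Local Open Scope ring_scope.

(** * Splitting a family of integers at a threshold *)

Section Splitting.
Variables (T : finType) (u : T -> nat).
Implicit Type A : {set T}.

Definition above A a := [set t in A | (a < u t)%N].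
Definition below A a := [set t in A | (u t < a)%N].

(** With [beta = p / #|A|], the parts [P] and [Q] have relative sizes at least
    [1 - beta] and [beta / 2], where [0 < beta <= 1 / 2]. *)
Definition halved A P Q :=
  exists p, [/\ 0 < p, 2 * p <= #|A|, #|A| - p <= #|P : {set T}| & p <= 2 * #|Q : {set T}|]%N.

Definition splits A a :=
  halved A (below A a) (above A a) \/ halved A (above A a) (below A a).

(** The size of a tree of splits is measured by square roots, since
    [sqrt (1 - beta) + sqrt (beta / 2) >= 1] for [beta <= 1 / 2]. *)
Lemma halved_leaves A P Q m n :
  halved A P Q -> (#|P| <= m ^ 2 -> #|Q| <= n ^ 2 -> #|A| <= (m + n) ^ 2)%N.
Proof.
move=> [p [p0 hp hP hQ]] hm hn.
have h1 : (p <= m ^ 2)%N by lia.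
have h2 : (p <= 2 * n ^ 2)%N by lia.
have h3 : (p <= 2 * (m * n))%N.
  rewrite -leq_sqr; have := leq_mul h1 h2; rewrite !expnMn; nia.
rewrite sqrnD; lia.
Qed.

Lemma card_below_above A a : (#|below A a.+1| + #|above A a| = #|A|)%N.
Proof.
rewrite -(cardsID [set t | (u t < a.+1)%N] A); congr (_ + _)%N; apply: eq_card => t.
  by rewrite !inE.
by rewrite !inE ltnS -ltnNge andbC.
Qed.

Lemma sum_odd_halves (R : realFieldType) n :
  \sum_(k < n) (2 * k + 1)%:R / 2 ^+ k.+1 <= 3 :> R.
Proof.
suff -> : \sum_(k < n) (2 * k + 1)%:R / 2 ^+ k.+1 = 3 - (2 * n + 3)%:R / 2 ^+ n :> R.
  by rewrite lerBlDr lerDl divr_ge0 // exprn_ge0.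
elim: n => [|n IH]; first by rewrite big_ord0 expr0; field.
rewrite big_ord_recr /= IH exprS !natrD !natrM -[n.+1]addn1 !natrD; field.
by rewrite expf_neq0.
Qed.

(** Layer-cake summation: [y^2] is the sum of the odd numbers [2 k + 1] over
    [k < y], and [sum_k (2 k + 1) / 2^(k + 1) = 3]. *)
Lemma second_moment_tail (R : realFieldType) A (y : T -> nat) :
  (forall k, 2 ^ k.+1 * #|[set t in A | (k < y t)%N]| <= #|A|)%N ->
  \sum_(t in A) (y t)%:R ^+ 2 <= 3 * #|A|%:R :> R.
Proof.
move=> tail; pose n := \max_t y t.
have yE t : (y t)%:R ^+ 2 = \sum_(k < n | (k < y t)%N) (2 * k + 1)%:R :> R.
  have sq j : j%:R ^+ 2 = \sum_(k < j) (2 * k + 1)%:R :> R.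
    elim: j => [|j IH]; first by rewrite big_ord0 expr0n.
    rewrite big_ord_recr /= -IH -[j.+1]addn1 !natrD ?natrM; ring.
  rewrite sq (big_ord_widen n (fun k => (2 * k + 1)%:R)) //.
  exact: leq_bigmax.
under eq_bigr do rewrite yE.
rewrite (exchange_big_dep predT) //=.
apply: (@le_trans _ _ (\sum_(k < n) ((2 * k + 1)%:R / 2 ^+ k.+1) * #|A|%:R)); last first.
  by rewrite -mulr_suml ler_wpM2r // sum_odd_halves.
apply: ler_sum => k _; rewrite sumr_const -[X in X <= _]mulr_natr -mulrA ler_wpM2l //.
rewrite ler_pdivlMl ?exprn_gt0 // -natrX -natrM ler_nat.
rewrite (eq_card (B := [set t in A | (k < y t)%N])) // => t.
by rewrite !inE.
Qed.

(** If no threshold splits [A], then above a median [c] each unit step at least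
    halves the number of [t] whose value is that large, and likewise below [c];
    so the values have geometric tails around [c]. *)
Lemma split_or_concentrated (R : realFieldType) A :
  (exists a, splits A a) \/
  exists c : nat, \sum_(t in A) ((u t)%:R - c%:R) ^+ 2 <= 6 * #|A|%:R :> R.
Proof.
have [?|nosplit] := pselect (exists a, splits A a); [by left|right].
pose up a := #|above A a|; pose dn a := #|below A a|.
have subA a b : (a <= b)%N -> (up b <= up a)%N.
  move=> ab; apply/subset_leq_card/fintype.subsetP => t; rewrite !inE => /andP[-> /=].
  exact: leq_ltn_trans.
have sumE a : (dn a.+1 + up a = #|A|)%N by exact: card_below_above.
(* Otherwise [a.+1] splits [A], the values greater than [a] being a minority
   of which at least half remain above [a.+1]. *)
have upE a : (2 * up a <= #|A| -> 2 * up a.+1 <= up a)%N.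
  move=> h; rewrite leqNgt; apply/negP => h2; apply: nosplit.
  have h3 := sumE a; have h4 : (up a.+1 <= up a)%N by exact: subA.
  exists a.+1; left; exists (up a); rewrite -/(up a.+1) -/(dn a.+1); split; lia.
have dnE a : (2 * dn a.+1 <= #|A| -> 2 * dn a <= dn a.+1)%N.
  move=> h; rewrite leqNgt; apply/negP => h2; apply: nosplit.
  have h3 := sumE a; have h4 : (dn a <= dn a.+1)%N.
    apply/subset_leq_card/fintype.subsetP => t; rewrite !inE => /andP[-> /=] /ltn_trans; exact.
  exists a; right; exists (dn a.+1); rewrite -/(up a) -/(dn a); split; lia.
have ex : exists c, (2 * up c <= #|A|)%N.
  exists (\max_t u t); rewrite /up (_ : above _ _ = finset.set0) ?cards0 ?muln0 //.
  apply/setP => t; rewrite !inE ltnNge (leq_bigmax t) andbF //.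
(* [c] is a median of [u] on [A]. *)
case: (ex_minnP ex) => c hc cmin.
have hdn : (2 * dn c <= #|A|)%N.
  case: c hc cmin => [|c] hc cmin.
    rewrite /dn (_ : below _ _ = finset.set0) ?cards0 //.
    by apply/setP => t; rewrite !inE ltn0 andbF.
  have := sumE c; have := cmin c; rewrite ltnn.
  case: leqP; last by lia.
  by move=> _ /(_ isT).
exists c.
have -> : \sum_(t in A) ((u t)%:R - c%:R) ^+ 2 =
   \sum_(t in A) (u t - c)%N%:R ^+ 2 + \sum_(t in A) (c - u t)%N%:R ^+ 2 :> R.
  rewrite -big_split; apply: eq_bigr => t _ /=.
  case: (leqP c (u t)) => h.
    rewrite natrB // (_ : c - u t = 0)%N ?expr0n ?addr0 //; lia.
  rewrite (natrB _ (ltnW h)) (_ : u t - c = 0)%N ?expr0n ?add0r //; last by lia.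
  by rewrite -sqrrN opprB.
have -> : 6 * #|A|%:R = 3 * #|A|%:R + 3 * #|A|%:R :> R by ring.
apply: lerD; apply: second_moment_tail => k.
  have -> : [set t in A | (k < u t - c)%N] = above A (c + k).
    by apply/setP => t; rewrite !inE ltn_subRL addnC.
  suff : (2 ^ k.+1 * up (c + k) <= #|A|)%N by [].
  elim: k => [|k IH]; first by rewrite addn0.
  have := upE (c + k)%N; rewrite addnS expnS; have := expn_gt0 2 k.+1.
  have := expnS 2 k; have := expn_gt0 2 k.
  nia.
have -> : [set t in A | (k < c - u t)%N] = below A (c - k).
  by apply/setP => t; rewrite !inE; congr (_ && _); lia.
suff : (2 ^ k.+1 * dn (c - k) <= #|A|)%N by [].
elim: k => [|k IH]; first by rewrite subn0.
have [ck|ck] := leqP c k.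
  rewrite (_ : c - k.+1 = 0)%N; last by lia.
  rewrite /dn (_ : below _ _ = finset.set0) ?cards0 ?muln0 //.
  by apply/setP => t; rewrite !inE ltn0 andbF.
have := dnE (c - k.+1)%N; rewrite (_ : (c - k.+1).+1 = c - k)%N; last by lia.
have := expnS 2 k.+1; have := expnS 2 k; have := expn_gt0 2 k.
nia.
Qed.

End Splitting.

(** * Counting shattered maps *)

Section ShatteredMaps.
Variables (T J : finType) (q : nat) (u : T -> J -> nat).
Implicit Types (A B : {set T}) (h : {ffun J -> option 'I_q}).

(** A partial map [h : J -> 'I_q] stands for a subset of [J], its domain,
    together with a level at each of its points.  The inequalities are strict on
    both sides, so that after rounding the real values are at a distance at
    least half a unit from [h j + 1 / 2]. *)
Definition realizes h (b : {ffun J -> bool}) t := [forall j,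
  if h j is Some a then if b j then a < u t j else u t j < a else true]%N.

Definition map_shattered A h := [forall b, [exists t in A, realizes h b t]].

Definition shattered_maps A := [set h | map_shattered A h].

Definition map_dom h := [set j | h j != None].

Lemma map_shatteredS A B h : A \subset B -> map_shattered A h -> map_shattered B h.
Proof.
move=> AB /forallP hA; apply/forallP => b.
have /existsP[t /andP[tA ht]] := hA b.
by apply/existsP; exists t; rewrite (fintype.subsetP AB).
Qed.

Lemma map_shattered_dom A h j a : h j = Some a -> map_shattered A h ->
  (exists2 t, t \in A & (a < u t j)%N) /\ (exists2 t, t \in A & (u t j < a)%N).
Proof.
move=> hj /forallP sh; split.
- have /existsP[t /andP[tA /forallP/(_ j)]] := sh [ffun=> true].
  by rewrite hj ffunE; exists t.
- have /existsP[t /andP[tA /forallP/(_ j)]] := sh [ffun=> false].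
  by rewrite hj ffunE; exists t.
Qed.

(** A map shattered by one of the two parts is shattered by [A].  A map
    shattered by both is undefined at [j], and extending it by the value [a] at
    [j] gives a further map that is shattered by [A] but by neither part.  So
    maps shattered by both parts are also counted twice on the right. *)
Lemma shattered_maps_split A j (a : 'I_q) :
  (#|shattered_maps (below (u^~ j) A a)| + #|shattered_maps (above (u^~ j) A a)|
    <= #|shattered_maps A|)%N.
Proof.
set Am := below _ _ _; set Ap := above _ _ _.
have AmA : Am \subset A by apply/fintype.subsetP => t; rewrite inE => /andP[].
have ApA : Ap \subset A by apply/fintype.subsetP => t; rewrite inE => /andP[].
rewrite -cardsUI; set X := shattered_maps Am; set Y := shattered_maps Ap.
pose ext h : {ffun J -> option 'I_q} := [ffun i => if i == j then Some a else h i].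
have XY_none h : h \in X :&: Y -> h j = None.
  rewrite !inE => /andP[hX hY]; case hj : (h j) => [c|//].
  have [[t tA ct] _] := map_shattered_dom hj hX.
  have [_ [s sA sc]] := map_shattered_dom hj hY.
  by move: tA sA; rewrite !inE /= => /andP[_ ?] /andP[_ ?]; lia.
have ext_inj : {in X :&: Y &, injective ext}.
  move=> h1 h2 /XY_none n1 /XY_none n2 /ffunP e; apply/ffunP => i.
  by have := e i; rewrite !ffunE; case: eqP => [->|//]; rewrite n1 n2.
rewrite -(card_in_imset ext_inj).
have dis : [disjoint X :|: Y & ext @: (X :&: Y)].
  rewrite disjoint_sym finset.disjoints_subset; apply/fintype.subsetP => _ /imsetP[h hXY ->].
  have ej : ext h j = Some a by rewrite ffunE eqxx.
  rewrite !inE negb_or; apply/andP; split; apply/negP => /(map_shattered_dom ej)[].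
    by case=> t; rewrite inE => /andP[_ /= ?] ?; lia.
  by move=> _ [t]; rewrite inE => /andP[_ /= ?] ?; lia.
have /eqP <- : (#|(X :|: Y) :|: ext @: (X :&: Y)| == #|X :|: Y| + #|ext @: (X :&: Y)|)%N.
  by rewrite (leq_card_setU _ _).
apply/subset_leq_card/fintype.subsetP => h /finset.setUP[/finset.setUP[]|/imsetP[h' hXY ->]].
- by rewrite !inE; apply: map_shatteredS.
- by rewrite !inE; apply: map_shatteredS.
move: (hXY) (XY_none _ hXY); rewrite !inE => /andP[/forallP hX /forallP hY] h'j.
apply/forallP => b.
have ext_real t : realizes h' b t -> (if b j then a < u t j else u t j < a)%N ->
    realizes (ext h') b t.
  move=> /forallP ht hj; apply/forallP => i; rewrite ffunE.
  by case: eqP => [->|_]; [|exact: ht].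
have [/existsP[t /andP[tA ht]] /existsP[s /andP[sA hs]]] := (hX b, hY b).
apply/existsP; move: tA sA; rewrite !inE /= => /andP[tA ta] /andP[sA sa].
case bj: (b j).
- by exists s; rewrite sA ext_real // bj.
- by exists t; rewrite tA ext_real // bj.
Qed.

(** Induction along the tree of splits; a leaf contributes the nowhere defined
    map. *)
Lemma card_le_shattered_maps B : (forall t j, u t j < q)%N ->
  (forall A, A \subset B -> 1 < #|A| -> exists j a, splits (u^~ j) A a)%N ->
  (#|B| <= #|shattered_maps B| ^ 2)%N.
Proof.
move=> uq hsplit.
suff H n A : A \subset B -> (#|A| <= n -> #|A| <= #|shattered_maps A| ^ 2)%N by exact: (H #|B|).
elim: n A => [|n IH] A AB An; first by lia.
have [A1|A1] := leqP #|A| 1.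
  have [->|[t tA]] := set_0Vmem A; first by rewrite cards0.
  rewrite (leq_trans A1) // expn_gt0 card_gt0; apply/orP; left; apply/set0Pn.
  exists [ffun=> None]; rewrite inE; apply/forallP => b; apply/existsP; exists t.
  by rewrite tA; apply/forallP => j; rewrite ffunE.
have [j [a sp]] := hsplit A AB A1.
have le_above : (#|above (u^~ j) A a| + #|below (u^~ j) A a| <= #|A|)%N.
  by rewrite -(card_below_above (u^~ j) A a) addnC leq_add2r subset_leq_card //;
     apply/fintype.subsetP => t; rewrite !inE => /andP[-> /= /ltnW].
have [aq|aq] := ltnP a q; last first.
  have above0 : above (u^~ j) A a = finset.set0.
    by apply/setP => t; rewrite !inE; apply/negP => /andP[_ /=]; have := uq t j; lia.
  by case: sp => -[p]; rewrite above0 cards0 => -[]; lia.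
have := shattered_maps_split A j (Ordinal aq); rewrite /= => le_sp.
have AmB : below (u^~ j) A a \subset B.
  by apply: fintype.subset_trans AB; apply/fintype.subsetP => t; rewrite inE => /andP[].
have ApB : above (u^~ j) A a \subset B.
  by apply: fintype.subset_trans AB; apply/fintype.subsetP => t; rewrite inE => /andP[].
have [Am0 Ap0] : (0 < #|below (u^~ j) A a| /\ 0 < #|above (u^~ j) A a|)%N.
  by case: sp => -[p [p0 pA hP hQ]]; split; lia.
have IHm := IH _ AmB; have IHp := IH _ ApB.
apply: (@leq_trans ((#|shattered_maps (below (u^~ j) A a)| +
  #|shattered_maps (above (u^~ j) A a)|) ^ 2)); last by rewrite leq_sqr.
case: sp => sp; [|rewrite addnC]; apply: (halved_leaves sp);
  by [apply: IHm; lia | apply: IHp; lia].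
Qed.

(** Markov's inequality for the weight [z ^ #|map_dom h|], whose sum over all
    partial maps factorises over [J]. *)
Lemma card_shattered_maps (R : realFieldType) B d (z : R) :
  0 < z -> z <= 1 -> (forall h, map_shattered B h -> #|map_dom h| <= d)%N ->
  #|shattered_maps B|%:R * z ^+ d <= (1 + q%:R * z) ^+ #|J|.
Proof.
move=> z0 z1 hd.
have -> : (1 + q%:R * z) ^+ #|J| =
    \sum_(h : {ffun J -> option 'I_q}) \prod_j (if h j is Some _ then z else 1).
  rewrite -(bigA_distr_bigA (fun _ o => if o is Some _ then z else 1)) prodr_const; congr (_ ^+ _).
  rewrite (bigD1 None) //=; congr (_ + _).
  rewrite (eq_bigr (fun=> z)); last by case.
  by rewrite sumr_const cardC1 card_option card_ord /= mulr_natl.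
have nneg h : 0 <= \prod_j (if h j is Some _ then z else 1).
  by apply: prodr_ge0 => j _; case: (h j) => // _; exact: ltW.
rewrite -sumr_const mulr_suml [X in _ <= X](bigID (mem (shattered_maps B))) /=.
rewrite -[X in X <= _]addr0 lerD ?sumr_ge0 // ler_sum // => h; rewrite inE => /hd domd.
rewrite (bigID (mem (map_dom h))) /= [X in _ <= _ * X]big1 ?mulr1; last first.
  by move=> j; rewrite inE negbK => /eqP ->.
rewrite (eq_bigr (fun=> z)); last by move=> j; rewrite inE; case: (h j).
by rewrite prodr_const mul1r ler_wiXn2l // ltW.
Qed.

End ShatteredMaps.

(** * Separation in mean square, and random sampling of coordinates *)

(** The square of the unnormalised Euclidean distance; the normalisation by the
    number of coordinates is in [l2_separated], where [r] is a squared scale. *)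
Definition sqdist (R : realType) (I : finType) (f g : I -> R) : R :=
  \sum_i (f i - g i) ^+ 2.

Definition l2_separated (R : realType) (T I : finType) (v : T -> I -> R) (r : R)
    (A : {set T}) : Prop :=
  {in A &, forall t t', t != t' -> r * #|I|%:R < sqdist (v t) (v t')}.

Lemma sqr_diff_le2 (R : realType) (a b c : R) :
  (a - b) ^+ 2 <= 2 * (a - c) ^+ 2 + 2 * (b - c) ^+ 2.
Proof. by have := sqr_ge0 (a + b - 2 * c); nra. Qed.

(** Without a split every coordinate has second moment at most [6 #|A|] about
    some centre, so the squared distance summed over all pairs is at most
    [24 #|J| #|A|^2], while separation makes it more than
    [48 #|J| (#|A|^2 - #|A|)]. *)
Lemma separated_splits (R : realType) (T J : finType) (u : T -> J -> nat) (A : {set T}) :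
  (1 < #|A|)%N -> l2_separated (fun t j => (u t j)%:R : R) 48 A ->
  exists j a, splits (u^~ j) A a.
Proof.
move=> A1 sepA; have [//|nosplit] := pselect (exists j a, splits (u^~ j) A a).
have conc j : exists c : nat, \sum_(t in A) ((u t j)%:R - c%:R) ^+ 2 <= 6 * #|A|%:R :> R.
  have [[a sp]|//] := split_or_concentrated (u^~ j) R A.
  by case: nosplit; exists j, a.
have N2 : 2 <= #|A|%:R :> R by rewrite ler_nat.
pose S : R := \sum_(t in A) \sum_(t' in A) sqdist (fun j => (u t j)%:R) (fun j => (u t' j)%:R).
have upS : S <= 24 * #|A|%:R ^+ 2 * #|J|%:R.
  have -> : S = \sum_j \sum_(t in A) \sum_(t' in A) ((u t j)%:R - (u t' j)%:R) ^+ 2.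
    rewrite exchange_big /=; apply: eq_bigr => t _.
    by rewrite exchange_big.
  rewrite mulr_natr -sumr_const; apply: ler_sum => j _.
  have [c hc] := conc j.
  apply: (@le_trans _ _ (\sum_(t in A) \sum_(t' in A)
     (2 * ((u t j)%:R - c%:R) ^+ 2 + 2 * ((u t' j)%:R - c%:R) ^+ 2))).
    by apply: ler_sum => t _; apply: ler_sum => t' _; exact: sqr_diff_le2.
  have -> : \sum_(t in A) \sum_(t' in A)
     (2 * ((u t j)%:R - c%:R) ^+ 2 + 2 * ((u t' j)%:R - c%:R) ^+ 2) =
     4 * #|A|%:R * \sum_(t in A) ((u t j)%:R - c%:R) ^+ 2 :> R.
    under eq_bigr do rewrite big_split /= sumr_const -mulr_sumr -[_ *+ #|A|]mulr_natr.
    rewrite big_split /= sumr_const -mulr_suml -!mulr_sumr -[_ *+ #|A|]mulr_natr; ring.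
  nra.
have loS : (#|A|%:R ^+ 2 - #|A|%:R) * (48 * #|J|%:R) < S.
  have -> : (#|A|%:R ^+ 2 - #|A|%:R) * (48 * #|J|%:R) =
      \sum_(t in A) \sum_(t' in A | t' != t) 48 * #|J|%:R :> R.
    rewrite (eq_bigr (fun=> (#|A|%:R - 1) * (48 * #|J|%:R))); last first.
      move=> t tA; have -> : #|A|%:R - 1 = #|A :\ t|%:R :> R.
        by rewrite (cardsD1 t A) tA natrD addrC addKr.
      rewrite [RHS]mulr_natl -[RHS]sumr_const; apply: eq_bigl => t'.
      by rewrite !inE andbC.
    rewrite sumr_const -[_ *+ #|A|]mulr_natr; ring.
  have sum_ne t : t \in A ->
      \sum_(t' in A) sqdist (fun j => (u t j)%:R) (fun j => (u t' j)%:R) =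
      \sum_(t' in A | t' != t) sqdist (fun j => (u t j)%:R) (fun j => (u t' j)%:R) :> R.
    move=> tA; rewrite (bigD1 t) //= [X in X + _]big1 ?add0r //.
    by move=> j _; rewrite subrr expr0n.
  rewrite /S (eq_bigr _ sum_ne).
  have other t : t \in A -> exists2 t', t' \in A & t' != t.
    move=> tA; have : (0 < #|A :\ t|)%N by rewrite (cardsD1 t A) tA in A1.
    by rewrite card_gt0 => /set0Pn[t']; rewrite !inE => /andP[]; exists t'.
  have [t0 t0A] : exists t, t \in A by apply/set0Pn; rewrite -card_gt0 ltnW.
  apply: ltr_sum => [|t tA]; first by apply/hasP; exists t0; rewrite ?mem_index_enum.
  have [t' t'A t't] := other t tA.
  apply: ltr_sum => [|s /andP[sA st]].
    by apply/hasP; exists t'; rewrite ?mem_index_enum ?t'A.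
  by apply: sepA; rewrite // eq_sym.
have J0 : 0 <= #|J|%:R :> R by [].
have : 0 <= #|J|%:R * (#|A|%:R * (#|A|%:R - 2)) :> R.
  by rewrite !mulr_ge0 // subr_ge0.
move=> hJ; suff : S < S by rewrite ltxx.
clear - upS loS hJ; clearbody S; nra.
Qed.

Lemma expRN_le (R : realType) (x : R) : 0 <= x <= 1 -> expR (- x) <= 1 - x / 2.
Proof.
move=> /andP[x0 x1]; rewrite expRN.
apply: (@le_trans _ _ (1 + x)^-1).
  by rewrite lef_pV2 ?posrE ?expR_gt0 ?expR_ge1Dx //; lra.
rewrite -[X in X <= _]mul1r ler_pdivrMr; nra.
Qed.

(** Draw [m] coordinates independently and uniformly.  For each pair in [A], an
    exponential moment bounds the probability that the mean squared distance in
    the sample is at most [r / 4] by [exp (- m r / 16)]; the number of pairs is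
    less than [exp (m r / 16)]. *)
Lemma sample_separated (R : realType) (T I : finType) (v : T -> I -> R) (A : {set T})
    (r : R) (m : nat) :
  (0 < #|I|)%N -> (0 < #|A|)%N -> (forall t i, `|v t i| <= 1) -> l2_separated v r A ->
  #|A|%:R ^+ 2 <= expR (m%:R * r / 16) ->
  exists s : {ffun 'I_m -> I}, l2_separated (fun t j => v t (s j)) (r / 4) A.
Proof.
move=> I0 A0 v1 sepA hm; apply: contrapT => nos.
pose x t t' i : R := (v t i - v t' i) ^+ 2 / 4.
have x01 t t' i : 0 <= x t t' i <= 1.
  have := v1 t i; have := v1 t' i; rewrite !ler_norml /x => /andP[? ?] /andP[? ?].
  by apply/andP; split; [rewrite divr_ge0 ?sqr_ge0|nra].
pose D := [set p : T * T | [&& p.1 \in A, p.2 \in A & p.1 != p.2]].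
have cardD : (#|D| < #|A| ^ 2)%N.
  rewrite -mulnn -cardsX; apply/proper_card/properP; split.
    by apply/fintype.subsetP => -[a b]; rewrite !inE /= => /and3P[-> ->].
  have /card_gt0P[a aA] := A0.
  by exists (a, a); rewrite !inE /= ?aA ?eqxx ?andbF.
(* Up to the factor [#|I| ^ m], [S] is the union bound for the probability
   that some pair fails. *)
pose S : R := \sum_(p in D) \sum_(s : {ffun 'I_m -> I})
  expR (m%:R * r / 16) * \prod_j expR (- x p.1 p.2 (s j)).
have loS : #|I|%:R ^+ m <= S.
  rewrite /S exchange_big /= -natrX -[m in (_ ^ m)%N]card_ord -card_ffun -sumr_const.
  apply: ler_sum => s _.
  have [p pD hp] : exists2 p, p \in D &
      sqdist (fun j => v p.1 (s j)) (fun j => v p.2 (s j)) <= r / 4 * m%:R.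
    apply: contrapT => nop; apply: nos; exists s => t t' tA t'A tt'.
    rewrite ltNge card_ord; apply/negP => h; apply: nop; exists (t, t') => //.
    by rewrite inE /= tA t'A.
  rewrite (bigD1 p) //= -[X in X <= _]addr0 lerD //; last first.
    by apply: sumr_ge0 => ? _; rewrite mulr_ge0 ?expR_ge0 ?prodr_ge0 // => *; exact: expR_ge0.
  rewrite -expR_sum -expRD -[X in X <= _]expR0 ler_expR sumrN.
  have -> : \sum_j x p.1 p.2 (s j) = sqdist (fun j => v p.1 (s j)) (fun j => v p.2 (s j)) / 4.
    by rewrite /sqdist mulr_suml.
  nra.
have upS : S <= #|D|%:R * #|I|%:R ^+ m * expR (- (m%:R * r / 16)).
  rewrite -mulrA mulr_natl -sumr_const; apply: ler_sum => p; rewrite inE => /and3P[pA p'A pp'].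
  rewrite -mulr_sumr -(bigA_distr_bigA (fun _ i => expR (- x p.1 p.2 i))) /= prodr_const card_ord.
  have -> : - (m%:R * r / 16) = m%:R * r / 16 + m%:R * (- (r / 8)) by field.
  rewrite expRD mulrCA ler_pM2l ?expR_gt0 // expRM_natl -exprMn.
  apply: lerXn2r; rewrite ?nnegrE ?mulr_ge0 ?expR_ge0 //.
    by apply: sumr_ge0 => i _; exact: expR_ge0.
  apply: (@le_trans _ _ (\sum_i (1 - x p.1 p.2 i / 2))).
    by apply: ler_sum => i _; exact: expRN_le.
  rewrite sumrB sumr_const -mulr_suml.
  have -> : \sum_i x p.1 p.2 i = sqdist (v p.1) (v p.2) / 4.
    by rewrite /sqdist mulr_suml.
  have := sepA _ _ pA p'A pp'; have := expR_ge1Dx (- (r / 8)).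
  have : 0 <= #|I|%:R :> R by [].
  by rewrite /= => *; nra.
have Im : 0 < #|I|%:R ^+ m :> R by rewrite exprn_gt0 // ltr0n.
have : #|D|%:R < expR (m%:R * r / 16).
  by apply: lt_le_trans hm; rewrite -natrX ltr_nat.
have := le_trans loS upS; rewrite mulrAC ler_pMl // expRN ler_pdivlMr ?expR_gt0 // mul1r.
by move=> /le_lt_trans h /h; rewrite ltxx.
Qed.

(** * The entropy bound *)

(** Shattering along an indexed family of points, in which repetitions are
    allowed: this is what sampling with replacement produces.  For
    [theta > 0] a shattered [s] indexes distinct points anyway. *)
Definition seq_shattered (R : realType) (Omega : Type) (J : finType) (F : set (Omega -> R))
    (y : J -> Omega) (theta : R) (s : {set J}) : Prop :=
  exists h : J -> R, forall b : J -> bool, exists2 f, F f &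
    forall j, j \in s -> if b j then h j + theta <= f (y j) else f (y j) <= h j - theta.

Definition seq_dim_le (R : realType) (Omega : Type) (F : set (Omega -> R)) (theta : R) (d : nat) :=
  forall m (y : 'I_m -> Omega) (s : {set 'I_m}), seq_shattered F y theta s -> (#|s| <= d)%N.

(** With values rounded down to multiples of [1 / c], where [c = 10 * 2^k], a
    [2^-k]-separated family becomes [48]-separated in squared integer units,
    hence splits.  A shattered map of the rounded family is shattered by [F] at
    scale [1 / (2 c)]. *)
Lemma sampled_entropy (R : realType) (Omega : Type) (F : set (Omega -> R)) (T : finType)
    (v : T -> Omega -> R) m (y : 'I_m -> Omega) (A : {set T}) (k d : nat) (theta : R) :
  (forall t, F (v t)) -> (forall f, F f -> forall o, `|f o| <= 1) ->
  theta <= (20 * 2 ^+ k)^-1 -> seq_dim_le F theta d ->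
  l2_separated (fun t j => v t (y j)) (4 ^- k) A ->
  #|A|%:R <= expR ((2 * (3 * k + 11) * d)%:R + m%:R * 21 / (1024 * 4 ^+ k)) :> R.
Proof.
move=> vF F1 thetak dimF sepA.
pose c : R := 10 * 2 ^+ k.
have c0 : 0 < c by rewrite mulr_gt0 // exprn_gt0.
pose u t j := Num.truncn ((v t (y j) + 1) * c).
have v01 t j : 0 <= (v t (y j) + 1) * c <= 2 * c.
  have := F1 _ (vF t) (y j); rewrite ler_norml => /andP[h1 h2].
  rewrite ler_pM2r // mulr_ge0 ?(ltW c0) //=; last by lra.
  lra.
have uE t j : (u t j)%:R <= (v t (y j) + 1) * c < (u t j)%:R + 1.
  by rewrite natr1; apply: truncn_itv; case/andP: (v01 t j).
pose q := (20 * 2 ^ k).+1.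
have uq t j : (u t j < q)%N.
  rewrite ltnS -(ler_nat R) natrM natrX.
  by have := uE t j; have := v01 t j; rewrite /c => /andP[_ h1] /andP[h2 _]; lra.
have sepu : l2_separated (fun t j => (u t j)%:R : R) 48 A.
  move=> t t' tA t'A tt'; have := sepA _ _ tA t'A tt'; rewrite /sqdist card_ord => sep.
  have c2 : c ^+ 2 = 100 * 4 ^+ k.
    by rewrite /c exprMn -exprM mulnC exprM -!natrX.
  apply: (@lt_le_trans _ _ (\sum_(j < m) (c ^+ 2 * (v t (y j) - v t' (y j)) ^+ 2 / 2 - 1))).
    rewrite sumrB sumr_const card_ord -mulr_suml -mulr_sumr c2.
    set S := \sum_(_ < _) _ in sep *.
    have : m%:R < 4 ^+ k * S by rewrite -ltr_pdivrMl ?exprn_gt0.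
    have : 0 <= m%:R :> R by [].
    by move=> ? ?; lra.
  apply: ler_sum => j _.
  have /andP[] := uE t j; have /andP[] := uE t' j.
  set a := v t _; set b := v t' _ => h1 h2 h3 h4.
  have -> : c ^+ 2 * (a - b) ^+ 2 = ((a + 1) * c - (b + 1) * c) ^+ 2 by ring.
  move: h1 h2 h3 h4; set x := (a + 1) * c; set x' := (b + 1) * c => h1 h2 h3 h4.
  have e1 : (x - x' - ((u t j)%:R - (u t' j)%:R)) ^+ 2 <= 1.
    by rewrite -real_normK ?num_real // expr_le1 // ler_norml; apply/andP; split; lra.
  have := sqr_ge0 (x - x' - 2 * ((u t j)%:R - (u t' j)%:R)).
  nra.
have cardA : (#|A| <= #|shattered_maps q u A| ^ 2)%N.
  apply: card_le_shattered_maps => // B BA B1.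
  by apply: separated_splits B1 _ => t t' tB t'B; apply: sepu; apply: (fintype.subsetP BA).
(* Small enough that [m q z] is at most a quarter of [log #|A|] for the
   sample size [m ~ 16 * 4^k log #|A|] used later. *)
pose z : R := 2 ^- (3 * k + 11).
have z0 : 0 < z by rewrite invr_gt0 exprn_gt0.
have z1 : z <= 1 by rewrite invf_le1 ?exprn_gt0 // exprn_ege1 // ler1n.
have := card_shattered_maps z0 z1 (q := q) (u := u) (B := A) (d := d).
rewrite card_ord; set S : R := #|shattered_maps q u A|%:R => hS.
have {hS} : S * z ^+ d <= (1 + q%:R * z) ^+ m.
  apply: hS => h /forallP sh.
  apply: (dimF _ y).
  exists (fun j => (if h j is Some a then (nat_of_ord a)%:R + 2^-1 else 0) / c - 1) => b.
  have /existsP[t /andP[_ /forallP ht]] := sh [ffun j => b j].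
  exists (v t) => // j; rewrite inE; have := ht j; rewrite ffunE.
  case: (h j) => // a ha _.
  have thc : theta * c <= 2^-1.
    rewrite -ler_pdivlMr //; apply: le_trans thetak _.
    by rewrite /c le_eqVlt; apply/orP; left; apply/eqP; field; rewrite expf_neq0.
  have /andP[h1 h2] := uE t j.
  case: (b j) ha => ha.
    rewrite -(ler_pM2r c0) -subr_ge0.
    have : a%:R + 1 <= (u t j)%:R :> R by rewrite natr1 ler_nat.
    have -> : v t (y j) * c - ((a%:R + 2^-1) / c - 1 + theta) * c =
      (v t (y j) + 1) * c - (a%:R + 2^-1) - theta * c by field; rewrite gt_eqF.
    lra.
  rewrite -(ler_pM2r c0) -subr_ge0.
  have : (u t j)%:R + 1 <= a%:R :> R by rewrite natr1 ler_nat.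
  have -> : ((a%:R + 2^-1) / c - 1 - theta) * c - v t (y j) * c =
     (a%:R + 2^-1) - theta * c - (v t (y j) + 1) * c by field; rewrite gt_eqF.
  lra.
have qz : 0 <= q%:R * z by rewrite mulr_ge0 // ltW.
move=> hS.
set e := (3 * k + 11)%N in z z0 z1 qz hS *.
have hexp : (1 + q%:R * z) ^+ m <= expR (m%:R * (q%:R * z)).
  rewrite expRM_natl lerXn2r ?nnegrE ?expR_ge0 ?expR_ge1Dx //.
  by rewrite addr_ge0.
have he : 1 <= expR (e * d)%:R * z ^+ d.
  rewrite /z exprVn -exprM ler_pdivlMr ?exprn_gt0 // mul1r -[X in expR X]mulr1 expRM_natl.
  by rewrite lerXn2r ?nnegrE ?expR_ge0 // (le_trans _ (expR_ge1Dx _)).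
have {}hS : S <= expR ((e * d)%:R + m%:R * (q%:R * z)).
  rewrite expRD; apply: (@le_trans _ _ (S * (expR (e * d)%:R * z ^+ d))).
    by rewrite ler_peMr.
  by rewrite mulrCA ler_pM2l ?expR_gt0 // (le_trans hS).
apply: (@le_trans _ _ (S ^+ 2)); first by rewrite -natrX ler_nat.
have -> : (2 * e * d)%:R + m%:R * 21 / (1024 * 4 ^+ k) =
    2%:R * ((e * d)%:R + m%:R * (21 * 2 ^+ k * z)) :> R.
  rewrite /z /e !natrM mulnC exprD exprM.
  have -> : (2 ^+ k) ^+ 3 = 2 ^+ k * 4 ^+ k :> R.
    have -> : 4 ^+ k = 2 ^+ k ^+ 2 :> R by rewrite -exprM mulnC exprM -!natrX.
    by ring.
  by field; rewrite !expf_neq0.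
rewrite expRM_natl lerXn2r ?nnegrE ?expR_ge0 //.
apply: le_trans hS _; rewrite ler_expR lerD2l ler_wpM2l // ler_pM2r //.
rewrite /q -natr1 natrM natrX.
have : 1 <= 2 ^+ k :> R by rewrite exprn_ege1 // ler1n.
lra.
Qed.

(** Sampling [m ~ 8 * 4^k log #|A|] points turns the term of [sampled_entropy]
    that depends on [m] into at most [(log #|A|) / 2], which is absorbed by the
    left-hand side. *)
Lemma l2_separated_entropy (R : realType) (Omega : Type) (F : set (Omega -> R)) (T I : finType)
    (v : T -> Omega -> R) (x : I -> Omega) (A : {set T}) (k d : nat) (theta : R) :
  (forall t, F (v t)) -> (forall f, F f -> forall o, `|f o| <= 1) ->
  theta <= (20 * 2 ^+ k)^-1 -> seq_dim_le F theta d ->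
  l2_separated (fun t i => v t (x i)) (4 / 4 ^+ k) A ->
  #|A|%:R <= expR (44 * d%:R * (k%:R + 1)) :> R.
Proof.
move=> vF F1 thetak dimF sepA.
have [A1|A1] := leqP #|A| 1.
  apply: (@le_trans _ _ 1); first by rewrite (ler_nat _ _ 1).
  by rewrite -expR0 ler_expR !mulr_ge0 // addr_ge0.
have /card_gt1P[t0 [t1 [t0A t1A t01]]] := A1.
have I0 : (0 < #|I|)%N.
  rewrite lt0n; apply/negP => /eqP I0.
  have := sepA _ _ t0A t1A t01; rewrite I0 mulr0 /sqdist big1 ?ltxx // => i.
  by have := fintype0 i I0.
pose L : R := ln #|A|%:R.
have LE : expR L = #|A|%:R by rewrite lnK // posrE ltr0n ltnW.
have L2 : 1 / 2 <= L.
  have h : expR (1 / 2) <= #|A|%:R :> R.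
    apply: (@le_trans _ _ 2); last by rewrite ler_nat.
    have := expR_ge1Dx (- (1 / 2) : R); rewrite expRN.
    by rewrite -[X in _ <= X]mul1r ler_pdivlMr ?expR_gt0 //; lra.
  by rewrite -ler_expR LE.
have k1 : 1 <= 4 ^+ k :> R by rewrite exprn_ege1 // ler1n.
pose m := (Num.truncn (8 * 4 ^+ k * L)).+1.
have /andP[m1 m2] : 8 * 4 ^+ k * L <= m%:R <= 16 * 4 ^+ k * L.
  have /truncn_itv/andP[h1 h2] : 0 <= 8 * 4 ^+ k * L by rewrite !mulr_ge0 //; lra.
  by rewrite (ltW h2) /= /m -natr1; nra.
have v1 t i : `|v t (x i)| <= 1 by exact: F1.
have [|s sepS] := sample_separated (m := m) I0 (ltnW A1) v1 sepA.
  rewrite -LE -expRM_natl ler_expR.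
  have -> : m%:R * (4 / 4 ^+ k) / 16 = m%:R / (4 * 4 ^+ k) :> R.
    by field; rewrite expf_neq0.
  by rewrite ler_pdivlMr; lra.
have sepS' : l2_separated (fun t j => v t (x (s j))) (4 ^- k) A.
  suff <- : 4 / 4 ^+ k / 4 = 4 ^- k :> R by exact: sepS.
  by field; rewrite expf_neq0.
have := sampled_entropy vF F1 thetak dimF sepS'.
rewrite -{1}LE ler_expR -LE ler_expR => h.
have hm : m%:R * 21 / (1024 * 4 ^+ k) <= L / 2.
  by rewrite ler_pdivrMr; lra.
have : (2 * (3 * k + 11) * d)%:R <= 22 * d%:R * (k%:R + 1) :> R.
  rewrite natrM natrM natrD natrM.
  have : 0 <= k%:R :> R by []. have : 0 <= d%:R :> R by [].
  nra.
lra.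
Qed.

(** * Chaining for random signs *)

Definition sgb (R : realType) (b : bool) : R := if b then 1 else -1.
Arguments sgb {R}.

Definition signed_sum (R : realType) (I : finType) (b : {ffun I -> bool}) (w : I -> R) : R :=
  \sum_i sgb (b i) * w i.

(** For [x < 1 / 2], [expR x <= (1 - x)^-1] and
    [(1 - x)^-1 + (1 + x)^-1 = 2 / (1 - x^2)]; for larger [x] already
    [x <= 2 x^2].  The optimal exponent is [x^2 / 2]. *)
Lemma cosh_le_expR_sqr (R : realType) (x : R) :
  expR x + expR (- x) <= 2 * expR (2 * x ^+ 2).
Proof.
wlog x0 : x / 0 <= x.
  move=> H; have [/H//|/ltW x0] := leP 0 x.
  by have := H (- x); rewrite opprK sqrrN addrC oppr_ge0; apply.
have [x2|x2] := leP (1 / 2) x.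
  have h1 : expR x <= expR (2 * x ^+ 2) by rewrite ler_expR; nra.
  have h2 : expR (- x) <= expR (2 * x ^+ 2) by rewrite ler_expR; nra.
  lra.
have h1 : expR x <= (1 - x)^-1.
  rewrite -{1}[x]opprK expRN lef_pV2 ?posrE ?expR_gt0 ?expR_ge1Dx //; lra.
have h2 : expR (- x) <= (1 + x)^-1.
  by rewrite expRN lef_pV2 ?posrE ?expR_gt0 ?expR_ge1Dx //; lra.
have h3 := expR_ge1Dx (2 * x ^+ 2).
have h4 : (1 - x)^-1 + (1 + x)^-1 = 2 / (1 - x ^+ 2).
  have [p1 p2 p3] : [/\ 1 - x != 0, 1 + x != 0 & 1 - x ^+ 2 != 0].
    by split; rewrite gt_eqF //; nra.
  by field; rewrite p1 p2 p3.
have h5 : 2 / (1 - x ^+ 2) <= 2 * (1 + 2 * x ^+ 2).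
  have y0 := sqr_ge0 x; have y1 : x ^+ 2 <= 1 / 4 by nra.
  by move: y0 y1; set y := x ^+ 2 => y0 y1; rewrite ler_pdivrMr; nra.
lra.
Qed.

Lemma signed_sum_mgf (R : realType) (I : finType) (w : I -> R) :
  \sum_(b : {ffun I -> bool}) expR (signed_sum b w) <=
  2 ^+ #|I| * expR (2 * \sum_i w i ^+ 2).
Proof.
under eq_bigr do rewrite expR_sum.
rewrite -(bigA_distr_bigA (fun i c => expR (sgb c * w i))) /=.
rewrite mulr_sumr expR_sum -prodr_const -big_split /=.
apply: ler_prod => i _; rewrite sumr_ge0 /= => [|c _]; last exact: expR_ge0.
by rewrite big_bool /= mul1r mulN1r cosh_le_expR_sqr.
Qed.

(** The maximum of few subgaussian sums: with [E = L + 2 lam^2 V], the selected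
    sum [X] satisfies [lam X <= E - 1 + expR (lam X - E)], and the exponential
    is at most its sum over all [p] in [D], whose mean is at most [1]. *)
Lemma signed_sum_max (R : realType) (I P : finType) (w : P -> I -> R) (D : {set P})
    (sel : {ffun I -> bool} -> P) (V L lam : R) :
  0 < lam -> (forall b, sel b \in D) -> (forall p, p \in D -> \sum_i w p i ^+ 2 <= V) ->
  #|D|%:R <= expR L ->
  \sum_(b : {ffun I -> bool}) signed_sum b (w (sel b)) <= 2 ^+ #|I| * (L / lam + 2 * lam * V).
Proof.
move=> lam0 selD wV DL.
pose E := L + 2 * lam ^+ 2 * V.
have lin b : lam * signed_sum b (w (sel b)) <=
    E - 1 + \sum_(p in D) expR (signed_sum b (fun i => lam * w p i)) * expR (- E).
  rewrite (bigD1 (sel b)) //= -expRD.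
  set Z := \sum_(_ in _ | _) _.
  have Z0 : 0 <= Z by apply: sumr_ge0 => p _; rewrite mulr_ge0 ?expR_ge0.
  have -> : signed_sum b (fun i => lam * w (sel b) i) = lam * signed_sum b (w (sel b)).
    by rewrite /signed_sum mulr_sumr; apply: eq_bigr => i _; rewrite mulrCA.
  have := expR_ge1Dx (lam * signed_sum b (w (sel b)) + - E); lra.
have cardb : #|{: {ffun I -> bool}}|%:R = 2 ^+ #|I| :> R.
  by rewrite card_ffun card_bool natrX.
have total : \sum_(b : {ffun I -> bool})
    \sum_(p in D) expR (signed_sum b (fun i => lam * w p i)) * expR (- E) <= 2 ^+ #|I|.
  rewrite exchange_big /=.
  apply: (@le_trans _ _ (\sum_(p in D) 2 ^+ #|I| * expR (- L))).
    apply: ler_sum => p pD; rewrite -mulr_suml.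
    have -> : - L = 2 * (lam ^+ 2 * V) - E by rewrite /E; ring.
    rewrite expRD mulrA ler_pM2r ?expR_gt0 //.
    apply: le_trans (signed_sum_mgf _) _; rewrite ler_pM2l ?exprn_gt0 // ler_expR ler_pM2l //.
    under eq_bigr do rewrite exprMn.
    by rewrite -mulr_sumr ler_pM2l ?exprn_gt0 // wV.
  rewrite sumr_const -[_ *+ #|D|]mulr_natr -mulrA ler_piMr ?exprn_ge0 //.
  by rewrite expRN mulrC ler_pdivrMr ?expR_gt0 // mul1r.
have : lam * \sum_(b : {ffun I -> bool}) signed_sum b (w (sel b)) <= 2 ^+ #|I| * E.
  rewrite mulr_sumr; apply: le_trans (ler_sum _ (fun b _ => lin b)) _.
  rewrite big_split /= sumr_const -[_ *+ #|_|]mulr_natr cardb; lra.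
rewrite -ler_pdivlMl // => /le_trans; apply.
by rewrite le_eqVlt /E; apply/orP; left; apply/eqP; field; rewrite gt_eqF.
Qed.

(** A separated set of maximal cardinality is a net. *)
Lemma exists_net (R : realType) (T I : finType) (v : T -> I -> R) (r : R) : 0 <= r ->
  exists A : {set T}, l2_separated v r A /\
    forall t, exists2 t', t' \in A & sqdist (v t) (v t') <= r * #|I|%:R.
Proof.
move=> r0.
pose sep (A : {set T}) := `[< l2_separated v r A >].
have sep0 : sep finset.set0 by apply/asboolP => t t'; rewrite inE.
case: (arg_maxnP (fun A : {set T} => #|A|) sep0) => A /asboolP sepA maxA.
exists A; split=> // t; apply: contrapT => far.
have {}far t' : t' \in A -> r * #|I|%:R < sqdist (v t) (v t').
  by move=> t'A; rewrite ltNge; apply/negP => h; apply: far; exists t'.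
have tA : t \notin A.
  apply/negP => /far; rewrite /sqdist big1 ?ltNge ?mulr_ge0 // => i _.
  by rewrite subrr expr0n.
suff /maxA : sep (t |: A) by rewrite /= cardsU1 tA add1n ltnn.
apply/asboolP => s s'; rewrite !inE => /predU1P[->|sA] /predU1P[->|s'A] ss'.
- by rewrite eqxx in ss'.
- exact: far.
- have -> : sqdist (v s) (v t) = sqdist (v t) (v s).
    by apply: eq_bigr => i _; rewrite -sqrrN opprB.
  exact: far.
- exact: sepA.
Qed.

Lemma sum_levels_le (R : realFieldType) n :
  \sum_(k < n) (k%:R + 2) / 2 ^+ k.+1 <= 3 :> R.
Proof.
suff -> : \sum_(k < n) (k%:R + 2) / 2 ^+ k.+1 = 3 - (n%:R + 3) / 2 ^+ n :> R.
  by rewrite lerBlDr lerDl divr_ge0 ?exprn_ge0 ?addr_ge0.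
elim: n => [|n IH]; first by rewrite big_ord0 expr0; field.
rewrite big_ord_recr /= IH exprS -[n.+1]addn1 !natrD; field.
by rewrite expf_neq0.
Qed.

Lemma sum_halves_le (R : realFieldType) n : \sum_(k < n) 2 ^- k.+1 <= 1 :> R.
Proof.
suff -> : \sum_(k < n) 2 ^- k.+1 = 1 - 2 ^- n :> R by rewrite lerBlDr lerDl invr_ge0 exprn_ge0.
elim: n => [|n IH]; first by rewrite big_ord0 expr0; field.
rewrite big_ord_recr /= IH exprS; field.
by rewrite expf_neq0.
Qed.

Lemma signed_sum_le (R : realType) (I : finType) (b : {ffun I -> bool}) (f g : I -> R) (r : R) :
  0 < r -> sqdist f g <= r ^+ 2 * #|I|%:R -> signed_sum b (fun i => f i - g i) <= r * #|I|%:R.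
Proof.
move=> r0 fg.
apply: (@le_trans _ _ (\sum_i ((f i - g i) ^+ 2 / (2 * r) + r / 2))).
  apply: ler_sum => i _; set w := f i - g i.
  have -> : w ^+ 2 / (2 * r) + r / 2 = (w ^+ 2 + r ^+ 2) / (2 * r) by field; rewrite gt_eqF.
  rewrite ler_pdivlMr ?mulr_gt0 // /sgb.
  by case: (b i); [have := sqr_ge0 (w - r)|have := sqr_ge0 (w + r)]; nra.
rewrite big_split /= -mulr_suml sumr_const -[_ *+ #|_|]mulr_natr -/(sqdist f g).
have : sqdist f g / (2 * r) <= r * #|I|%:R / 2 by rewrite ler_pdivrMr ?mulr_gt0 //; lra.
lra.
Qed.

Lemma sum_signed_sum_const (R : realType) (I : finType) (w : I -> R) :
  \sum_(b : {ffun I -> bool}) signed_sum b w = 0.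
Proof.
pose neg (b : {ffun I -> bool}) : {ffun I -> bool} := [ffun i => ~~ b i].
have negK : involutive neg by move=> b; apply/ffunP => i; rewrite !ffunE negbK.
have : \sum_b signed_sum b w = - \sum_b signed_sum b w.
  rewrite {1}(reindex_inj (inv_inj negK)) -sumrN; apply: eq_bigr => b _.
  rewrite /signed_sum -sumrN; apply: eq_bigr => i _; rewrite ffunE /sgb.
  by case: (b i); rewrite /= ?mul1r ?mulN1r ?opprK.
lra.
Qed.

(** Chaining: each [w t] is approximated in nets at squared scales [4 / 4^k] for
    [k <= M].  The coarsest net has one point, whose signed sums average to [0];
    the links between consecutive nets are few by the entropy bound and are
    treated by [signed_sum_max] with [lam = a 2^(k + 1)]; the error beyond the
    finest net is bounded by the Cauchy-Schwarz inequality. *)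
Lemma signed_sum_chaining (R : realType) (Omega : Type) (F : set (Omega -> R)) (T I : finType)
    (v : T -> Omega -> R) (x : I -> Omega) (sel : {ffun I -> bool} -> T)
    (d M : nat) (theta a : R) :
  (forall t, F (v t)) -> (forall f, F f -> forall o, `|f o| <= 1) ->
  ((0 < M)%N -> theta <= (20 * 2 ^+ M)^-1) -> seq_dim_le F theta d -> 0 < a ->
  \sum_(b : {ffun I -> bool}) signed_sum b (fun i => v (sel b) (x i)) <=
  2 ^+ #|I| * (264 * d%:R / a + 80 * a * #|I|%:R + 2 / 2 ^+ M * #|I|%:R).
Proof.
move=> vF F1 thetaM dimF a0.
pose w t i := v t (x i).
pose N : R := #|I|%:R.
have N0 : 0 <= N by [].
pose r k : R := 4 / 4 ^+ k.
have r0 k : 0 < r k by rewrite divr_gt0 ?exprn_gt0.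
have [A hA] := choice (fun k => exists_net w (ltW (r0 k))).
have near_net k t : exists t', t' \in A k /\ sqdist (w t) (w t') <= r k * N.
  by have [t' ? ?] := (hA k).2 t; exists t'.
pose pi k := projT1 (choice (near_net k)).
have hpi k : forall t, pi k t \in A k /\ sqdist (w t) (w (pi k t)) <= r k * N.
  exact: projT2 (choice (near_net k)).
(* Functions bounded by [1] are never at a squared distance more than [4]. *)
have pi0 t t' : pi 0%N t = pi 0%N t'.
  apply/eqP; apply: contraT => ne.
  have := (hA 0%N).1 _ _ (hpi 0%N t).1 (hpi 0%N t').1 ne; rewrite ltNge => /negP[].
  rewrite /r expr0 divr1 mulr_natr -sumr_const; apply: ler_sum => i _.
  have := F1 _ (vF (pi 0%N t)) (x i); have := F1 _ (vF (pi 0%N t')) (x i).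
  by rewrite !ler_norml /w => /andP[? ?] /andP[? ?]; nra.
have cardA k : (k <= M)%N -> (0 < M)%N -> #|A k|%:R <= expR (44 * d%:R * (k%:R + 1)) :> R.
  move=> kM M0; apply: (l2_separated_entropy vF F1 _ dimF (hA k).1).
  apply: le_trans (thetaM M0) _.
  rewrite lef_pV2 ?posrE ?mulr_gt0 ?exprn_gt0 // ler_pM2l //.
  by rewrite ler_weXn2l // ler1n.
pose W (p : T * T) i := w p.1 i - w p.2 i.
pose link k t := (pi k.+1 t, pi k t).
have decomp b t : signed_sum b (w t) = signed_sum b (w (pi 0%N t)) +
    \sum_(k < M) signed_sum b (W (link k t)) + signed_sum b (fun i => w t i - w (pi M t) i).
  rewrite /signed_sum exchange_big -!big_split /=; apply: eq_bigr => i _.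
  rewrite -mulr_sumr -!mulrDr; congr (_ * _).
  rewrite -(big_mkord predT (fun k => W (link k t) i)) telescope_sumr //; ring.
have level k : (k < M)%N ->
    \sum_(b : {ffun I -> bool}) signed_sum b (W (link k (sel b))) <=
    2 ^+ #|I| * (88 * d%:R / a * ((k%:R + 2) / 2 ^+ k.+1) + 80 * a * N * 2 ^- k.+1).
  move=> kM; pose D := [set link k t | t : T].
  have M0 : (0 < M)%N by exact: leq_ltn_trans kM.
  have lam0 : 0 < a * 2 ^+ k.+1 by rewrite mulr_gt0 ?exprn_gt0.
  have WV p : p \in D -> \sum_i W p i ^+ 2 <= 40 / 4 ^+ k.+1 * N.
    move=> /imsetP[t _ ->]; rewrite /W /=.
    apply: (@le_trans _ _ (2 * sqdist (w t) (w (pi k.+1 t)) + 2 * sqdist (w t) (w (pi k t)))).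
      rewrite /sqdist !mulr_sumr -big_split /=; apply: ler_sum => i _.
      rewrite -[(w t i - _) ^+ 2]sqrrN opprB -[(w t i - w (pi k t) i) ^+ 2]sqrrN opprB.
      exact: sqr_diff_le2.
    have := (hpi k.+1 t).2; have := (hpi k t).2; rewrite /r.
    have -> : 40 / 4 ^+ k.+1 * N = 2 * (4 / 4 ^+ k.+1 * N) + 2 * (4 / 4 ^+ k * N).
      by rewrite exprS; field; rewrite expf_neq0.
    lra.
  have cardD : #|D|%:R <= expR (88 * d%:R * (k%:R + 2)) :> R.
    have DA : (#|D| <= #|A k.+1| * #|A k|)%N.
      rewrite -cardsX; apply/subset_leq_card/fintype.subsetP => _ /imsetP[t _ ->].
      by rewrite inE /= (hpi k.+1 t).1 (hpi k t).1.
    apply: (@le_trans _ _ (#|A k.+1| * #|A k|)%:R); first by rewrite ler_nat.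
    rewrite natrM; apply: le_trans (ler_pM _ _ (cardA k.+1 kM M0) (cardA k (ltnW kM) M0)) _ => //.
    rewrite -expRD ler_expR -natr1.
    have : 0 <= d%:R :> R by []. lra.
  have selD b : link k (sel b) \in D by exact: imset_f.
  apply: le_trans (signed_sum_max lam0 selD WV cardD) _.
  rewrite ler_pM2l ?exprn_gt0 // le_eqVlt; apply/orP; left; apply/eqP.
  have -> : 4 ^+ k.+1 = (2 ^+ k.+1) ^+ 2 :> R by rewrite -exprM mulnC exprM -!natrX.
  have a_neq0 : a != 0 by rewrite gt_eqF.
  have pow_neq0 : 2 ^+ k.+1 != 0 :> R by rewrite expf_neq0.
  by field; rewrite a_neq0 pow_neq0.
rewrite (eq_bigr _ (fun b _ => decomp b (sel b))) !big_split /=.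
have -> : \sum_(b : {ffun I -> bool}) signed_sum b (w (pi 0%N (sel b))) = 0.
  rewrite (eq_bigr (fun b => signed_sum b (w (pi 0%N (sel [ffun=> true]))))).
    exact: sum_signed_sum_const.
  by move=> b _; rewrite (pi0 _ (sel [ffun=> true])).
rewrite add0r mulrDr lerD //.
  rewrite exchange_big /=.
  apply: (@le_trans _ _ (\sum_(k < M) 2 ^+ #|I| *
      (88 * d%:R / a * ((k%:R + 2) / 2 ^+ k.+1) + 80 * a * N * 2 ^- k.+1))).
    by apply: ler_sum => k _; exact: level.
  rewrite -mulr_sumr ler_pM2l ?exprn_gt0 // big_split /= -!mulr_sumr.
  apply: lerD.
    have -> : 264 * d%:R / a = 88 * d%:R / a * 3 by ring.
    by rewrite ler_wpM2l ?sum_levels_le // divr_ge0 // ltW.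
  by rewrite -[X in _ <= X]mulr1 ler_wpM2l ?sum_halves_le // !mulr_ge0 // ltW.
have -> : 2 ^+ #|I| = #|{: {ffun I -> bool}}|%:R :> R by rewrite card_ffun card_bool natrX.
rewrite [X in _ <= X]mulr_natl -[X in _ <= X]sumr_const; apply: ler_sum => b _.
apply: signed_sum_le; first by rewrite divr_gt0 ?exprn_gt0.
have -> : (2 / 2 ^+ M) ^+ 2 = r M; last exact: (hpi M (sel b)).2.
by rewrite /r exprMn exprVn -exprM mulnC exprM -!natrX.
Qed.

(** * From finite sequences of points to the shattering dimension *)

Local Open Scope classical_set_scope.

(** A convex combination of numbers all smaller than [G] cannot equal [G]. *)
Lemma conv_hull_linear_le (R : realType) (Omega : Type) (F : set (Omega -> R)) (I : finType)
    (x : I -> Omega) (c : I -> R) (g : Omega -> R) :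
  conv_hull F g -> exists2 f, F f & \sum_i c i * g (x i) <= \sum_i c i * f (x i).
Proof.
move=> [n [w [f [w0 w1 Ff gE]]]].
pose G := \sum_i c i * g (x i); pose Y j := \sum_i c i * f j (x i).
have GE : G = \sum_j w j * Y j.
  rewrite /Y; under [RHS]eq_bigr do rewrite mulr_sumr.
  rewrite exchange_big /=; apply: eq_bigr => i _.
  by rewrite gE mulr_sumr; apply: eq_bigr => j _; rewrite mulrCA.
apply: contrapT => nof.
have YG j : Y j < G by rewrite ltNge; apply/negP => h; apply: nof; exists (f j).
have sum0 : \sum_j w j * (G - Y j) = 0.
  under eq_bigr do rewrite mulrBr.
  by rewrite sumrB -mulr_suml w1 mul1r -GE subrr.
have terms_ge0 j : true -> 0 <= w j * (G - Y j) by rewrite mulr_ge0 // subr_ge0 ltW.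
have wz j : w j = 0.
  have /eqP : w j * (G - Y j) = 0 by exact: (psumr_eq0P terms_ge0 sum0 isT).
  by rewrite mulf_eq0 subr_eq0 (gt_eqF (YG j)) orbF => /eqP.
by move: w1; rewrite big1 => [/eqP|//]; rewrite eq_sym oner_eq0.
Qed.

(** Compares the lower bound [n eps] for the mean signed sum, which shattering
    by the convex hull gives, with the upper bound of [signed_sum_chaining]. *)
Lemma conv_seq_shattered_card (R : realType) : exists2 K : R, 0 < K &
  forall (Omega : Type) (F : set (Omega -> R)) (I : finType) (x : I -> Omega) (eps : R) (d : nat),
  (forall f, F f -> forall o, `|f o| <= 1) -> 0 < eps ->
  seq_shattered (conv_hull F) x eps [set: I]%SET -> seq_dim_le F (1 / 160 * eps) d ->
  #|I|%:R <= (K / eps) ^+ 2 * d%:R.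
Proof.
exists 600; first by rewrite ltr0n.
move=> Omega F I x eps d F1 eps0 [h sh] dimF; set N : R := #|I|%:R.
have pick_f (b : {ffun I -> bool}) : exists f, F f /\
    signed_sum b h + eps * N <= signed_sum b (fun i => f (x i)).
  have [g Fg hg] := sh b.
  have [f Ff gf] := conv_hull_linear_le x (fun i => sgb (b i)) Fg.
  exists f; split=> //; apply: le_trans gf.
  rewrite mulr_natr -[X in _ + X]sumr_const -big_split; apply: ler_sum => i _ /=.
  by have := hg i (finset.in_setT i); rewrite /sgb; case: (b i); lra.
have [f hf] := choice pick_f.
have lower : 2 ^+ #|I| * (eps * N) <= \sum_b signed_sum b (fun i => f b (x i)).
  apply: (@le_trans _ _ (\sum_b (signed_sum b h + eps * N))); last first.
    by apply: ler_sum => b _; exact: (hf b).2.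
  rewrite big_split /= sum_signed_sum_const add0r sumr_const card_ffun card_bool.
  by rewrite -[X in _ <= X]mulr_natl natrX.
(* The chaining stops at the first scale at most [eps / 2]: the error beyond
   it costs half of the lower bound, and all scales in use exceed [eps / 4]. *)
have exM : exists M, 2 / 2 ^+ M <= eps / 2 :> R.
  pose m := (Num.truncn (4 / eps)).+1; exists m.
  have h4 : 4 / eps < m%:R.
    by have /truncn_itv/andP[] : 0 <= 4 / eps by rewrite divr_ge0 // ltW.
  have hm : m%:R <= 2 ^+ m :> R by rewrite -natrX ler_nat ltnW // ltn_expl.
  rewrite ler_pdivrMr ?exprn_gt0 //; rewrite ltr_pdivrMr // in h4.
  nra.
case: (ex_minnP exM) => M hM Mmin.
have thetaM : (0 < M)%N -> 1 / 160 * eps <= (20 * 2 ^+ M)^-1.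
  case: M hM Mmin => // M hM Mmin _; have := Mmin M; rewrite ltnn.
  case: (leP (2 / 2 ^+ M) (eps / 2)) => [_ /(_ isT)//|h4 _].
  rewrite -[X in _ <= X]mul1r ler_pdivlMr ?mulr_gt0 ?exprn_gt0 //.
  rewrite ltr_pdivlMr ?exprn_gt0 // in h4.
  by rewrite exprS; lra.
have a0 : 0 < eps / 320 by rewrite divr_gt0.
have := signed_sum_chaining x id (fun b => (hf b).1) F1 thetaM dimF a0.
move=> /(le_trans lower); rewrite ler_pM2l ?exprn_gt0 // -/N.
have -> : 264 * d%:R / (eps / 320) = 264 * 320 * d%:R / eps by field; rewrite gt_eqF.
have N0 : 0 <= N by [].
move=> hN; have : eps * N / 4 <= 264 * 320 * d%:R / eps by nra.
rewrite ler_pdivlMr // => hN'.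
rewrite exprMn exprVn mulrAC ler_pdivlMr ?exprn_gt0 //.
have : 0 <= d%:R :> R by [].
nra.
Qed.

Lemma vc_ge_finite (R : realType) (Omega : Type) (F : set (Omega -> R)) (theta : R)
    (X : {fset {classic Omega}}) :
  shattered theta F [set` X] -> ((#|` X|%:R)%:E <= vc F theta)%E.
Proof.
move=> sh; apply: ereal_sup_ubound; exists [set` X]; first by right.
by rewrite /counting /=; case: ifPn => [_|/asboolP[]//]; rewrite set_fsetK.
Qed.

(** A shattered sequence has distinct points, for two equal ones would need both
    [h j + theta <= h j' - theta] and the same with [j] and [j'] exchanged. *)
Lemma seq_dim_le_vc (R : realType) (Omega : Type) (F : set (Omega -> R)) (theta r : R) :
  0 < theta -> (vc F theta <= r%:E)%E -> seq_dim_le F theta (Num.truncn r).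
Proof.
move=> theta0 vcr m y s [h sh].
have inj : {in s &, injective y}.
  move=> j j' js j's yjj'; apply: contrapT => /eqP jj'.
  have [f _ hf] := sh (fun i => i == j); have [g _ hg] := sh (fun i => i == j').
  have := hf _ js; have := hf _ j's; have := hg _ js; have := hg _ j's.
  rewrite !eqxx (eq_sym j') (negbTE jj') yjj'; lra.
pose X : {fset {classic Omega}} := [fset (y j : {classic Omega}) | j in s]%fset.
have cardX : #|` X| = #|s| by rewrite card_in_imfset //= -cardE.
rewrite -cardX; suff : shattered theta F [set` X].
  move=> /vc_ge_finite/le_trans/(_ vcr); rewrite lee_fin => Xr.
  have r0 : 0 <= r by apply: le_trans Xr.
  by have /andP[_] := truncn_itv r0; rewrite -ltnS -(ltr_nat R); apply: le_lt_trans.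
exists (fun o => if [pick j in s | `[< y j = o >]] is Some j then h j else 0) => s' s'X.
have [f Ff hf] := sh (fun j => ~~ `[< s' (y j) >]).
have pickE j : j \in s -> [pick j' in s | `[< y j' = y j >]] = Some j.
  move=> js; case: pickP => [j' /andP[j's /asboolP/(inj _ _ j's js) ->]//|/(_ j)].
  by rewrite js /=; case: asboolP.
exists f => //; split=> o.
  move=> s'o; have /imfsetP[j /= js ojE] := s'X _ s'o.
  by have := hf j js; rewrite ojE in s'o *; rewrite pickE //; case: asboolP.
move=> [/imfsetP[j /= js ->] ns'].
by have := hf j js; rewrite pickE //; case: asboolP.
Qed.

Lemma counting_set0 (T : choiceType) (R : realType) : counting (@set0 T) = 0 :> \bar R.
Proof. by rewrite /counting asboolT // fset_set0 cardfs0. Qed.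

Lemma vc_ge0 (R : realType) (Omega : Type) (F : set (Omega -> R)) (t : R) : (0 <= vc F t)%E.
Proof. by apply: ereal_sup_ubound; exists set0; [left|rewrite counting_set0]. Qed.

Theorem corollary4p3 (R : realType) :
  exists K c : R, [/\ 0 < K, 0 < c &
    forall (Omega : Type) (F : set (Omega -> R)) (eps : R),
      F !=set0 ->
      (forall f, F f -> forall x, `|f x| <= 1) ->
      0 < eps ->
      (vc (conv_hull F) eps <= ((K / eps) ^+ 2)%:E * vc F (c * eps))%E].
Proof.
have [K K0 card_le] := conv_seq_shattered_card R.
exists K, (1 / 160); split=> //.
move=> Omega F eps _ F1 eps0.
have C0 : 0 < (K / eps) ^+ 2 by rewrite exprn_gt0 // divr_gt0.
have := vc_ge0 F (1 / 160 * eps); case vcE : (vc _ _) => [r| |] // r0; last first.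
  by rewrite gt0_muley ?lte_fin // leey.
have dimF : seq_dim_le F (1 / 160 * eps) (Num.truncn r).
  by apply: seq_dim_le_vc; rewrite ?vcE // mulr_gt0.
have trunc_r : (Num.truncn r)%:R <= r by have /andP[] := truncn_itv r0.
apply: ge_ereal_sup => _ [s [->|[h sh]] <-].
  by rewrite counting_set0 mule_ge0 // lee_fin ltW.
have bound (X : {fset {classic Omega}}) : [set` X] `<=` s ->
    #|` X|%:R <= (K / eps) ^+ 2 * r.
  move=> Xs; apply: (@le_trans _ _ ((K / eps) ^+ 2 * (Num.truncn r)%:R)); last first.
    by rewrite ler_pM2l.
  rewrite cardfE.
  apply: (card_le _ _ _ (fun i : X => val i : Omega) _ _ F1 eps0 _ dimF).
  exists (fun i : X => h (val i : {classic Omega})) => b.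
  have [|g Fg [gle gge]] := sh [set o | exists2 i : X, ~~ b i & (val i : {classic Omega}) = o].
    by move=> _ [i _ <-]; apply: Xs; exact: valP.
  exists g => // i _; case: ifPn => bi.
    apply: gge; split; first by apply: Xs; exact: valP.
    by move=> [j bj /val_inj ji]; rewrite ji bi in bj.
  by apply: gle; exists i.
rewrite -EFinM /counting /=; case: ifPn => [/asboolP fins|/asboolP infs].
  by rewrite lee_fin; apply: bound; rewrite fset_setK.
have [X Xs] := infinite_set_fset (Num.truncn ((K / eps) ^+ 2 * r)).+1 infs.
have /truncn_itv/andP[_] : 0 <= (K / eps) ^+ 2 * r by rewrite mulr_ge0 // ltW.
move=> h1; rewrite -(ler_nat R) => h2.
by have := bound X Xs; rewrite leNgt (lt_le_trans h1 h2).
Qed.
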